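(* Let $f:[\underline{x},\overline{x}]\to\mathbb{R}$ be strictly concave and $N\ge 3$. If $(x_1,x_2,\dots,x_N)$ is a breakpoint set on $[\underline{x},\overline{x}]$ that is optimal for minimizing the area difference error, then $x_i=\varTheta(x_{i-1},x_{i+1})$ for all $i\in\{2,3,\dots,N-1\}$.
   Context: For $u<v$ in $[\underline{x},\overline{x}]$, let $L_{u,v}(x)=f(u)+\frac{f(v)-f(u)}{v-u}(x-u)$ be the linear function through $(u,f(u))$ and $(v,f(v))$, and let $A(u,v)=\int_u^v|f(x)-L_{u,v}(x)|\,dx$ be the area between $f$ and $L_{u,v}$ on $[u,v]$. For $a<b$, $\varTheta(a,b)$ denotes the optimal value of the interior point $c\in(a,b)$ under the minimal area difference error criterion, i.e. the value of $c\in(a,b)$ minimizing $A(a,c)+A(c,b)$. A breakpoint set with $N$ breakpoints on $[\underline{x},\overline{x}]$ is a tuple $(x_1,\dots,x_N)$ with $x_1=\underline{x}$, $x_N=\overline{x}$ (fixed endpoints) and $x_i<x_{i+1}$ for all $i$. Its area difference error is $\sum_{i=1}^{N-1}A(x_i,x_{i+1})$. It is optimal for minimizing the area difference error if this sum is minimal among all breakpoint sets with $N$ breakpoints on $[\underline{x},\overline{x}]$. *)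

(* Defs.v *)
From mathcomp Require Import all_boot all_order all_algebra.
From mathcomp Require Import all_classical all_reals all_analysis.

Set Implicit Arguments.
Unset Strict Implicit.
Unset Printing Implicit Defensive.

Import Order.TTheory GRing.Theory Num.Theory.
Import numFieldNormedType.Exports.

Local Open Scope classical_set_scope.
Local Open Scope ring_scope.

(* A function on [xl, xu] is represented by a total f : R -> R; every notion
   below only depends on the values of f on [xl, xu]. Continuity is not assumed:
   f may jump at xl and at xu. *)

Definition strictly_concave_on (R : realType) (f : R -> R) (xl xu : R) : Prop :=
  forall x y t : R, x \in `[xl, xu] -> y \in `[xl, xu] -> x != y ->
    0 < t < 1 -> t * f x + (1 - t) * f y < f (t * x + (1 - t) * y).

Definition chord (R : realType) (f : R -> R) (u v x : R) : R :=
  f u + (f v - f u) / (v - u) * (x - u).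

Definition area (R : realType) (f : R -> R) (u v : R) : R :=
  \int[@lebesgue_measure R]_(x in `[u, v]) `|f x - chord f u v x|.

Definition minimizes_area (R : realType) (f : R -> R) (a b c : R) : Prop :=
  a < c < b /\
  forall c', a < c' < b -> area f a c + area f c b <= area f a c' + area f c' b.

(* The unique minimizer in ]a, b[. If there is none, or more than one, the value
   is a, which lies outside ]a, b[ (see ThetaP). *)
Definition Theta (R : realType) (f : R -> R) (a b : R) : R :=
  xget a [set c | unique (minimizes_area f a b) c].

Lemma ThetaP (R : realType) (f : R -> R) (a b c : R) : a < c < b ->
  c = Theta f a b <-> unique (minimizes_area f a b) c.
Proof.
move=> /andP[ac _]; rewrite /Theta; split=> [|cU].
  case: xgetP => [d -> dU -> //|_ ca].
  by rewrite ca ltxx in ac.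
case: xgetP => [d -> [dM _]|/(_ c)//].
exact: (proj2 cU).
Qed.

(* Tuples are indexed from 0, so the breakpoint x_i is x`_i.-1. *)
Definition breakpoint_set (R : realType) (xl xu : R) (N : nat)
    (x : N.-tuple R) : Prop :=
  [/\ x`_0 = xl, x`_N.-1 = xu &
      forall i : nat, (i.+1 < N)%N -> x`_i < x`_i.+1].

Definition area_error (R : realType) (f : R -> R) (N : nat)
    (x : N.-tuple R) : R :=
  \sum_(0 <= i < N.-1) area f x`_i x`_i.+1.

Definition optimal_breakpoint_set (R : realType) (f : R -> R) (xl xu : R)
    (N : nat) (x : N.-tuple R) : Prop :=
  breakpoint_set xl xu x /\
  forall y : N.-tuple R, breakpoint_set xl xu y ->
    area_error f x <= area_error f y.

(* Main.v *)
(* Write I for the integral of f over [a, b]. Concavity puts f above its chords,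
   so A(u, v) is the integral of f minus the area of a trapezoid, and
   A(a, c) + A(c, b) = I - ((c - a) f(a) + (b - a) f(c) + (b - c) f(b)) / 2.
   This is strictly convex in c, hence has at most one minimizer. In an optimal
   breakpoint set, x_i is a minimizer between its neighbours, since moving x_i
   alone yields another breakpoint set. *)
Require Import Defs.
From mathcomp Require Import all_boot all_order all_algebra.
From mathcomp Require Import all_classical all_reals all_analysis.
From mathcomp Require Import measurable_realfun ring lra zify.

Set Implicit Arguments.
Unset Strict Implicit.
Unset Printing Implicit Defensive.

Import Order.TTheory GRing.Theory Num.Theory.
Import numFieldNormedType.Exports.

Local Open Scope classical_set_scope.
Local Open Scope ring_scope.

(** * Inequalities for strictly concave functions *)

Lemma strictly_concave_onS (R : realType) (f : R -> R) (a b u v : R) :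
  strictly_concave_on f a b -> a <= u -> v <= b -> strictly_concave_on f u v.
Proof.
move=> cf au vb x y t; rewrite !in_itv/= => /andP[ux xv] /andP[uy yv].
by apply: cf; rewrite in_itv/= ?(le_trans au) ?(le_trans _ vb).
Qed.

(** This is concavity with weight [(v - z) / (v - u)] at [u], which represents [z], multiplied
    through by [v - u] so that later steps avoid division. *)
Lemma strictly_concave_on_lt (R : realType) (f : R -> R) (u z v : R) :
  strictly_concave_on f u v -> u < z < v ->
  (v - z) * f u + (z - u) * f v < (v - u) * f z.
Proof.
move=> cf /andP[uz zv]; have uv := lt_trans uz zv.
have uv0 : 0 < v - u by rewrite subr_gt0.
have zE : z = (v - z) / (v - u) * u + (1 - (v - z) / (v - u)) * v.
  by field; rewrite gt_eqF.
have := cf u v ((v - z) / (v - u)); rewrite !in_itv/= !lexx (ltW uv) lt_eqF//.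
rewrite -zE divr_gt0 ?subr_gt0// ltr_pdivrMr// mul1r => /(_ isT isT isT).
rewrite ltrD2l ltrN2 uz => /(_ isT); rewrite -(ltr_pM2l uv0).
by congr (_ < _); field; rewrite gt_eqF.
Qed.

Lemma strictly_concave_on_le (R : realType) (f : R -> R) (u z v : R) :
  strictly_concave_on f u v -> u <= z <= v ->
  (v - z) * f u + (z - u) * f v <= (v - u) * f z.
Proof.
move=> cf /andP[]; rewrite le_eqVlt => /predU1P[<- _|uz].
  by rewrite subrr mul0r addr0.
rewrite le_eqVlt => /predU1P[->|zv]; first by rewrite subrr mul0r add0r.
by rewrite ltW// strictly_concave_on_lt// uz.
Qed.

(** Quasi-concavity: a weighted mean of [f u] and [f v] is at least their minimum. It yields both
    measurability and the lower bound on [f]. *)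
Lemma strictly_concave_on_ge_min (R : realType) (f : R -> R) (u z v : R) :
  strictly_concave_on f u v -> u <= z <= v -> Num.min (f u) (f v) <= f z.
Proof.
move=> cf uzv; have /andP[uz zv] := uzv; have := le_trans uz zv.
rewrite le_eqVlt => /predU1P[uv|uv].
  have -> : z = u by apply/eqP; rewrite eq_le uz uv zv.
  by rewrite ge_min lexx.
have uv0 : 0 < v - u by rewrite subr_gt0.
rewrite -(ler_pM2l uv0); apply: le_trans (strictly_concave_on_le cf uzv).
have -> : (v - u) * Num.min (f u) (f v) =
  (v - z) * Num.min (f u) (f v) + (z - u) * Num.min (f u) (f v) by ring.
by rewrite lerD// ler_wpM2l ?subr_ge0// ge_min lexx ?orbT.
Qed.

Lemma chord_le (R : realType) (f : R -> R) (u z v : R) : u < v ->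
  strictly_concave_on f u v -> u <= z <= v -> chord f u v z <= f z.
Proof.
move=> uv cf /(strictly_concave_on_le cf).
have uv0 : 0 < v - u by rewrite subr_gt0.
rewrite -(@ler_pM2l _ (v - u) _ (chord f u v z))//; congr (_ <= _).
by rewrite /chord; field; rewrite gt_eqF.
Qed.

(** * Integrability on a segment *)

(* The superlevel sets of a concave function are intervals. *)
Lemma strictly_concave_on_measurable (R : realType) (f : R -> R) (u v : R) :
  strictly_concave_on f u v -> measurable_fun `[u, v] f.
Proof.
move=> cf mD; apply: (measurability _ (RGenOInfty.measurableE R)) => //.
move=> /= _ [_ [t ->] <-]; apply: is_interval_measurable => x y /=.
rewrite !in_itv/= !andbT => -[/andP[ux xv] tx] [/andP[uy yv] ty] z /andP[xz zy].
rewrite !in_itv/= andbT (le_trans ux xz) (le_trans zy yv); split => //.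
have cxy := strictly_concave_onS cf ux yv.
by apply: lt_le_trans (strictly_concave_on_ge_min cxy _);
  rewrite ?lt_min ?tx ?xz.
Qed.

(** The endpoint values bound [f] from below. For the upper bound, reflect [z] in the midpoint [c]:
    concavity gives [f z + f (u + v - z) < 2 * f c], and the reflected value is at least [m]. Jumps
    at the endpoints are thus covered. *)
Lemma strictly_concave_on_bounded (R : realType) (f : R -> R) (u v : R) :
  strictly_concave_on f u v -> [bounded f x | x in `[u, v]].
Proof.
move=> cf; pose m := Num.min (f u) (f v); pose c := (u + v) / 2.
have fm z : u <= z <= v -> m <= f z by exact: strictly_concave_on_ge_min.
have fM z : u <= z <= v -> f z <= Num.max (f c) (2 * f c - m).
  (* The midpoint is its own reflection, and strict concavity applies only to distinct points; hence
     the [f c] in the maximum. *)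
  move=> /andP[uz zv]; have [->|zc] := eqVneq z c; first by rewrite le_max lexx.
  have mz : m <= f (u + v - z) by apply: fm; lra.
  have := cf z (u + v - z) 2^-1.
  have -> : 2^-1 * z + (1 - 2^-1) * (u + v - z) = c by rewrite /c; field.
  move=> cfz; rewrite le_max; apply/orP; right.
  have : 2^-1 * f z + (1 - 2^-1) * f (u + v - z) < f c.
    apply: cfz; rewrite ?in_itv/=; try lra.
    by apply: contra zc => /eqP zE; apply/eqP; rewrite /c; lra.
  lra.
exists (`|m| + `|Num.max (f c) (2 * f c - m)|); split; first exact: num_real.
move=> M mM z /=; rewrite in_itv/= => uzv; rewrite (le_trans _ (ltW mM))//.
have := fm z uzv; have := fM z uzv; set K := Num.max _ _ => fK mf.
by rewrite ler_norml; have := ler_norm K; have := ler_norm (- m);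
  rewrite normrN; have := normr_ge0 m; have := normr_ge0 K; lra.
Qed.

Lemma strictly_concave_on_integrable (R : realType) (f : R -> R) (u v : R) :
  strictly_concave_on f u v ->
  lebesgue_measure.-integrable `[u, v] (EFin \o f).
Proof.
move=> cf; apply: measurable_bounded_integrable => //.
- by rewrite /= lebesgue_measure_itv/=; case: ifP; rewrite ?ltry.
- exact: strictly_concave_on_measurable.
- exact: strictly_concave_on_bounded.
Qed.

(** * The area formula and uniqueness of the minimizer *)

Lemma chord_continuous (R : realType) (f : R -> R) (u v : R) :
  continuous (chord f u v).
Proof.
move=> x; rewrite /chord; apply: cvgD; first exact: cvg_cst.
apply: cvgM; first exact: cvg_cst.
by apply: cvgB; [exact: cvg_id|exact: cvg_cst].
Qed.

Lemma chord_integrable (R : realType) (f : R -> R) (u v : R) :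
  lebesgue_measure.-integrable `[u, v] (EFin \o chord f u v).
Proof.
apply: continuous_compact_integrable; first exact: segment_compact.
by apply: continuous_subspaceT; exact: chord_continuous.
Qed.

Lemma Rintegral_chord (R : realType) (f : R -> R) (u v : R) : u < v ->
  \int[@lebesgue_measure R]_(x in `[u, v]) chord f u v x =
  (v - u) * (f u + f v) / 2.
Proof.
move=> uv; pose k := (f v - f u) / (v - u).
(* An antiderivative of the chord, whose slope is [k]. *)
pose F x : R := f u * x + k / 2 * (x - u) ^+ 2.
have dF (x : R) : is_derive x 1 F (chord f u v x).
  rewrite /F; apply: is_derive_eq.
  by rewrite /chord -/k /GRing.scale/=; field.
have cF (x : R) : {for x, continuous F}.
  by apply: differentiable_continuous; apply/derivable1_diffP; have [] := dF x.
rewrite /Rintegral (@continuous_FTC2 _ _ F)//.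
- rewrite /= /F /k; field; by rewrite subr_eq0 gt_eqF.
- by apply: continuous_subspaceT; exact: chord_continuous.
- split=> [x _||]; first by have [] := dF x.
  + by apply: cvg_at_right_filter; exact: cF.
  + by apply: cvg_at_left_filter; exact: cF.
- by move=> x _; rewrite derive1E; apply: derive_val.
Qed.

Lemma area_strictly_concave (R : realType) (f : R -> R) (u v : R) : u < v ->
  strictly_concave_on f u v ->
  area f u v = \int[@lebesgue_measure R]_(x in `[u, v]) f x
               - (v - u) * (f u + f v) / 2.
Proof.
move=> uv cf; rewrite -(Rintegral_chord f uv) -RintegralB//.
- apply: eq_Rintegral => x; rewrite inE/= in_itv/= => uxv.
  by rewrite ger0_norm// subr_ge0 chord_le.
- exact: strictly_concave_on_integrable.
- exact: chord_integrable.
Qed.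

Lemma areaD_strictly_concave (R : realType) (f : R -> R) (a b c : R) :
  strictly_concave_on f a b -> a < c < b ->
  area f a c + area f c b = \int[@lebesgue_measure R]_(x in `[a, b]) f x
    - ((c - a) * f a + (b - a) * f c + (b - c) * f b) / 2.
Proof.
move=> cf /andP[ac cb].
have cfac := strictly_concave_onS cf (lexx a) (ltW cb).
have cfcb := strictly_concave_onS cf (ltW ac) (lexx b).
have := Rintegral_itvB (strictly_concave_on_integrable cf)
  (_ : (BLeft a <= BRight c)%O) (_ : (BRight c <= BRight b)%O).
rewrite !bnd_simp (ltW ac) (ltW cb) => /(_ isT isT).
(* Subtracting the integral over [[a, c]] leaves the half-open interval from [c] to [b]; adding the
   point [c] does not change the integral. *)
rewrite Rintegral_itv_obnd_cbnd; last first.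
  apply: integrableS (strictly_concave_on_integrable cf) => // x /=.
  by rewrite !in_itv/= => /andP[cx ->]; rewrite (ltW (lt_trans ac cx)).
rewrite !area_strictly_concave//.
by move=> E; rewrite -E; field.
Qed.

Lemma minimizes_area_unique (R : realType) (f : R -> R) (a b c c' : R) :
  strictly_concave_on f a b ->
  minimizes_area f a b c -> minimizes_area f a b c' -> c = c'.
Proof.
move=> cf [acb minc] [ac'b minc'].
have [//|cc'] := eqVneq c c'.
have /andP[ac cb] := acb; have /andP[ac' c'b] := ac'b.
(* At the midpoint of two distinct minimizers the affine terms of the area formula average out,
   while [f d] exceeds the mean of [f c] and [f c']. The error at [d] is then below the mean of two
   minimal errors, a contradiction. *)
pose d := 2^-1 * c + (1 - 2^-1) * c'.
have adb : a < d < b by rewrite /d; lra.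
have := cf c c' 2^-1; rewrite !in_itv/= -/d.
have -> : a <= c <= b by rewrite (ltW ac) (ltW cb).
have -> : a <= c' <= b by rewrite (ltW ac') (ltW c'b).
have -> : 0 < (2^-1 : R) < 1 by lra.
move=> /(_ isT isT cc' isT) fd.
have ba : 0 < b - a by lra.
have := minc d adb; have := minc' d adb; rewrite !areaD_strictly_concave//.
by move: fd; rewrite -(ltr_pM2l ba) /d; lra.
Qed.

(** * Moving one breakpoint *)

(** Isolates the two summands of the error that change when the breakpoint of index [k.+1] moves. *)
Lemma sum_nat_split2 (V : nmodType) (F : nat -> V) (k n : nat) :
  (k.+1 < n)%N ->
  \sum_(0 <= j < n) F j =
  \sum_(0 <= j < k) F j + (F k + F k.+1 + \sum_(k.+2 <= j < n) F j).
Proof.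
move=> kn; rewrite (@big_cat_nat _ _ _ k)//=; last by lia.
congr (_ + _); rewrite big_ltn; last by lia.
by rewrite (@big_ltn _ _ _ k.+1) ?addrA.
Qed.

Lemma optimal_minimizes_area (R : realType) (f : R -> R) (xl xu : R) (N k : nat)
    (x : N.-tuple R) : (k.+2 < N)%N -> optimal_breakpoint_set f xl xu x ->
  minimizes_area f x`_k x`_k.+2 x`_k.+1.
Proof.
move=> kN [[x0 xN xlt] xopt]; split.
  by rewrite !xlt//; lia.
move=> c /andP[xkc cxk].
pose s j := if j == k.+1 then c else x`_j.
pose y : N.-tuple R := [tuple of mkseq s N].
have yE j : (j < N)%N -> y`_j = s j by move=> jN; rewrite nth_mkseq.
have /xopt : breakpoint_set xl xu y.
  (* The moved index [k.+1] is neither [0] nor [N.-1], so the endpoints stay fixed; only the two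
     comparisons involving [c] are new. *)
  split; rewrite ?yE /s; try lia.
  - by [].
  - by rewrite ifF//; apply/eqP; lia.
  - move=> j jN; rewrite !yE /s; try lia.
    rewrite eqSS; case: eqVneq => [->|_]; first by rewrite gtn_eqF.
    by case: eqVneq => [->//|_]; exact: xlt.
rewrite /area_error !(@sum_nat_split2 _ _ k N.-1); try lia.
have -> : \sum_(0 <= j < k) area f y`_j y`_j.+1 =
          \sum_(0 <= j < k) area f x`_j x`_j.+1.
  apply: eq_big_nat => j jk; rewrite !yE; try lia.
  by rewrite /s !ltn_eqF//; lia.
have -> : \sum_(k.+2 <= j < N.-1) area f y`_j y`_j.+1 =
          \sum_(k.+2 <= j < N.-1) area f x`_j x`_j.+1.
  apply: eq_big_nat => j jk; rewrite !yE; try lia.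
  by rewrite /s !gtn_eqF//; lia.
rewrite lerD2l lerD2r !yE; try lia.
by rewrite /s eqxx ltn_eqF// gtn_eqF.
Qed.

(** Allows concavity to be restricted to the segment between the two neighbours of a breakpoint. *)
Lemma breakpoint_set_le (R : realType) (xl xu : R) (N : nat) (x : N.-tuple R)
    (i : nat) : breakpoint_set xl xu x -> (i < N)%N -> xl <= x`_i <= xu.
Proof.
move=> [<- <- xlt] iN.
have mono m n : (m <= n)%N -> (n < N)%N -> x`_m <= x`_n.
  elim: n => [|n IHn]; first by rewrite leqn0 => /eqP->.
  rewrite leq_eqVlt => /predU1P[->//|mn nN].
  by rewrite (le_trans (IHn _ _)) ?ltW ?xlt//; lia.
by rewrite !mono//; lia.
Qed.

Theorem theorem4 (R : realType) (f : R -> R) (xl xu : R) (N : nat)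
    (x : N.-tuple R) :
  strictly_concave_on f xl xu ->
  (3 <= N)%N ->
  optimal_breakpoint_set f xl xu x ->
  forall i : nat, (0 < i < N.-1)%N -> x`_i = Theta f x`_i.-1 x`_i.+1.
Proof.
move=> cf _ xopt [//|k] /= kN.
have kN2 : (k.+2 < N)%N by lia.
have xmin := optimal_minimizes_area kN2 xopt.
(* [ThetaP] asks for a minimizer, supplied by optimality, and for its uniqueness, supplied by
   concavity between the neighbours. *)
apply/ThetaP; first exact: xmin.1.
split=> // c; apply: minimizes_area_unique xmin.
have /andP[xlk _] := breakpoint_set_le xopt.1 (ltnW (ltnW kN2)).
have /andP[_ xuk] := breakpoint_set_le xopt.1 kN2.
exact: strictly_concave_onS cf xlk xuk.
Qed.
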